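(* Let $B=[a,b]\times[c,d]\subset\mathbb{R}^2$ be a rectangle with sides parallel to the coordinate axes and let $K\in\mathcal{M}_B^{hv}$. For every $\varepsilon>0$ the following hold. (i) There exists $\delta_\infty>0$ such that for every $L\in\mathcal{M}_B^{hv}$ with $\|f_L-f_K\|_{\infty,B}<\delta_\infty$ there is $K'\in\mathcal{M}_B^{hv}$ having the same coordinate X-rays as $K$ almost everywhere and satisfying $H(L,K')<\varepsilon$. (ii) There exists $\delta_1>0$ such that for every $L\in\mathcal{M}_B^{hv}$ with $\|f_L-f_K\|_{1,B}<\delta_1$ there is $K'\in\mathcal{M}_B^{hv}$ having the same coordinate X-rays as $K$ almost everywhere and satisfying $H(L,K')<\varepsilon$.
   Context: Here $a<b$ and $c<d$. A set $K\subset\mathbb{R}^2$ is hv-convex if its intersection with every horizontal line and with every vertical line is convex. $\mathcal{M}_B^{hv}$ denotes the collection of all non-empty compact connected hv-convex sets $L\subset\mathbb{R}^2$ whose axis parallel bounding box (the intersection of all axis parallel boxes containing $L$, possibly degenerate) is contained in $B$. $H$ is the Hausdorff metric (with respect to the Euclidean distance). For a compact set $K\subset\mathbb{R}^2$ the generalized conic function is $f_K(x,y):=\int_K \big(|x-\alpha|+|y-\beta|\big)\,d\alpha\, d\beta$ for $(x,y)\in\mathbb{R}^2$. The norms are $\|f\|_{\infty,B}:=\sup_{(x,y)\in B}|f(x,y)|$ and $\|f\|_{1,B}:=\int_B|f(x,y)|\,dx\,dy$. The coordinate X-rays of a compact set $K$ are the functions $Y_K(x):=\lambda_1(\{\beta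 : (x,\beta)\in K\})$ and $X_K(y):=\lambda_1(\{\alpha : (\alpha,y)\in K\})$, where $\lambda_1$ is one-dimensional Lebesgue measure; $K$ and $K'$ have the same coordinate X-rays almost everywhere if $Y_K=Y_{K'}$ and $X_K=X_{K'}$ $\lambda_1$-almost everywhere on $\mathbb{R}$. *)

(* Defs.v *)
From mathcomp Require Import all_boot all_order all_algebra.
From mathcomp Require Import all_classical all_reals all_analysis.
Set Implicit Arguments.
Unset Strict Implicit.
Unset Printing Implicit Defensive.
Import Order.TTheory GRing.Theory Num.Theory.
Import numFieldNormedType.Exports.

Local Open Scope classical_set_scope.
Local Open Scope ring_scope.

Section generalized_conics.
Context {R : realType}.
Implicit Types (p q : R * R) (A B K : set (R * R)).

Definition box (a b c d : R) : set (R * R) := `[a, b] `*` `[c, d].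

Definition is_box A :=
  exists a b c d : R, [/\ a <= b, c <= d & A = box a b c d].

Definition bounding_box A : set (R * R) :=
  \bigcap_(D in [set D | is_box D /\ A `<=` D]) D.

Definition horizontal_line (y : R) : set (R * R) := [set p | p.2 = y].
Definition vertical_line (x : R) : set (R * R) := [set p | p.1 = x].

(* R^o * R^o is R * R with its structure of vector space over R. *)
Definition hv_convex K :=
  (forall y, @convex_set R (R^o * R^o)%type (K `&` horizontal_line y)) /\
  (forall x, @convex_set R (R^o * R^o)%type (K `&` vertical_line x)).

(* The topology of R * R is the product topology, i.e. the Euclidean one. *)
Definition hv_class B : set (set (R * R)) :=
  [set L | [/\ L !=set0, compact L, connected L, hv_convex L
             & bounding_box L `<=` B]].

(* The norm of the library on R * R is the max norm, hence this definition. *)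
Definition euclidean_dist p q : R :=
  Num.sqrt ((p.1 - q.1) ^+ 2 + (p.2 - q.2) ^+ 2).

Definition dist_to A p : \bar R :=
  ereal_inf [set (euclidean_dist p q)%:E | q in A].

Definition hausdorff_dist A B : \bar R :=
  Order.max (ereal_sup [set dist_to B p | p in A])
            (ereal_sup [set dist_to A q | q in B]).

Definition lebesgue2 :
    {measure set (measurableTypeR R * measurableTypeR R) -> \bar R} :=
  (@lebesgue_measure R \x @lebesgue_measure R)%E.

Definition conic_fun K p : R :=
  \int[lebesgue2]_(q in K) (`|p.1 - q.1| + `|p.2 - q.2|).

Definition sup_norm B (f : R * R -> R) : \bar R :=
  ereal_sup [set `|f p|%:E | p in B].

Definition L1_norm B (f : R * R -> R) : \bar R :=
  (\int[lebesgue2]_(p in B) `|f p|%:E)%E.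

Definition Yray K (x : R) : \bar R := lebesgue_measure (xsection K x).
Definition Xray K (y : R) : \bar R := lebesgue_measure (ysection K y).

Definition same_Xrays_ae K K' :=
  {ae @lebesgue_measure R, forall x, Yray K x = Yray K' x} /\
  {ae @lebesgue_measure R, forall y, Xray K y = Xray K' y}.

End generalized_conics.

(* Main.v *)
Require Import Defs.
From mathcomp Require Import all_boot all_order all_algebra.
From mathcomp Require Import all_classical all_reals all_analysis.
From mathcomp Require Import measurable_realfun ring lra.
Set Implicit Arguments.
Unset Strict Implicit.
Unset Printing Implicit Defensive.
Import Order.TTheory GRing.Theory Num.Theory.
Import numFieldNormedType.Exports.
Local Open Scope classical_set_scope.
Local Open Scope ring_scope.

(** Both statements are compactness statements.  If the first one failed for
    some [eps], then for every [delta > 0] the class would contain a set [L]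
    with [f_L] within [delta] of [f_K] that is [eps]-far from every set of the
    class with the X-rays of [K].  An ultrafilter containing all these families
    of counterexamples has a limit set [L0], and [L0] contradicts the choice of
    the family, by the following three facts.

    - [L0] belongs to the class ([ultra_limit_hv_class]), and almost all sets
      of the family are close to [L0] for the Hausdorff distance
      ([hausdorff_near_ultra_limit]).  Compactness of the box plays here the
      role of Blaschke's selection theorem.  The only geometric input is
      [connected_crossing]: a compact connected set that is convex along
      horizontal lines and contains points on both sides of a vertical line
      meets this line at a height between the heights of the two points.

    - The conic functions of the family converge to [f_L0], uniformly on the
      box ([conic_fun_ultra_limit]).  All sets of the class that are
      [e]-close to [L0], and [L0] itself, lie between [core e L0], the set of
      points whose four open quadrants, pushed away by [e], all meet [L0], and
      the neighbourhood [nbh e L0].  When [e] tends to 0 the gap between the two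
      decreases to the points of [L0] at which one open quadrant misses [L0].
      These points form four monotone relations, and a monotone relation is a
      null set because only countably many of its vertical sections have more
      than one point ([monotone_relation_null], [core_null]).

    - Hence [f_L0 = f_K] on the box, and a conic function determines the
      X-rays almost everywhere ([conic_fun_determines_Xrays]).  Up to a
      constant, [f_K] restricted to a horizontal line is the integral over [K]
      of [|x - alpha|]; its right derivative at [x] is the mass of [K] on the
      left of [x] minus the mass on the right, so [f_K] determines the mass of
      all vertical slabs of [K], that is, all integrals of the X-ray over
      intervals.

    The second statement follows from the first one: the conic functions of the
    sets of the class have a common Lipschitz constant, so a small integral of
    [|f_L - f_K|] forces a small supremum ([L1_small_sup_small]). *)

(** * Connected sets convex along one coordinate *)

(** Stated for two abstract coordinates [f] and [g], so that it serves for both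
    axes.  Heights [g w] of points [w] of [L] with [f w <= t] and with
    [t <= f w] form two closed sets, and they cover the segment between [g p]
    and [g q] since [g @` L] is an interval.  If they were disjoint on this
    segment they would disconnect it, so they share a height, where convexity
    yields [w]. *)
Lemma connected_crossing (R : realType) (T : topologicalType) (f g : T -> R)
    (L : set T) (t : R) (p q : T) :
    continuous f -> continuous g -> compact L -> connected L ->
    (forall u v, L u -> L v -> g u = g v -> f u <= t <= f v ->
      exists w, [/\ L w, f w = t & g w = g u]) ->
    L p -> L q -> f p <= t <= f q ->
  exists w, [/\ L w, f w = t & Num.min (g p) (g q) <= g w <= Num.max (g p) (g q)].
Proof.
move=> fc gc Lco Lcn Lcv Lp Lq /andP[fp fq].
set m := Num.min _ _; set M := Num.max _ _; apply: contrapT => no.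
have mp : m <= g p <= M by rewrite ge_min lexx le_max lexx.
have mq : m <= g q <= M by rewrite ge_min lexx le_max lexx !orbT.
have cl (P : set T) : closed P -> closed (g @` (L `&` P)).
  move=> cP; apply: compact_closed; first exact: Rhausdorff.
  apply: continuous_compact; first exact: continuous_subspaceT.
  exact: compact_closedI.
have clI : closed `[m, M] by exact: itv_closed.
(* The cut of the segment by the two sides of [t]. *)
pose A := g @` (L `&` [set z | f z <= t]) `&` `[m, M].
pose B := g @` (L `&` [set z | t <= f z]) `&` `[m, M].
have cA : closed A.
  apply: closedI => //; apply: cl.
  by have /continuous_closedP := fc; move/(_ _ (@closed_le R t)).
have cB : closed B.
  apply: closedI => //; apply: cl.
  by have /continuous_closedP := fc; move/(_ _ (@closed_ge R t)).
have AB y : A y -> B y -> False.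
  move=> [[u [Lu /= fu] <-] guI] [[v [Lv /= fv] gv] _].
  have [w [Lw fw gw]] := Lcv u v Lu Lv (esym gv) (introT andP (conj fu fv)).
  by apply: no; exists w; split => //; rewrite gw; move: guI; rewrite in_itv.
have sepAB : separated A B.
  split; apply/seteqP; split => // y /= [Ay By].
    by apply: (AB y) => //; rewrite (closure_id A).1.
  by apply: (AB y) => //; rewrite (closure_id B).1.
have gLi : is_interval (g @` L).
  apply/connected_intervalP/connected_continuous_connected => //.
  exact: continuous_subspaceT.
have IAB : `[m, M] `<=` A `|` B.
  move=> y /= yI; have : (g @` L) y.
    have Gm : (g @` L) m.
      by rewrite /m /Num.min; case: ifP => _; [exists p|exists q].
    have GM : (g @` L) M.
      by rewrite /M /Num.max; case: ifP => _; [exists q|exists p].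
    by apply: (gLi m M Gm GM); move: yI; rewrite in_itv.
  case=> z Lz gz; case: (leP (f z) t) => ft; [left|right].
    by split => //; exists z.
  by split => //; exists z => //; split => //=; exact: ltW.
case: (connected_subset sepAB IAB (@segment_connected _ m M)) => sub.
- apply: (AB (g q)); first by apply: sub; rewrite /= in_itv.
  by split; [exists q | rewrite /= in_itv].
- apply: (AB (g p)); last by apply: sub; rewrite /= in_itv.
  by split; [exists p | rewrite /= in_itv].
Qed.

(** Convexity is used below only through these two betweenness properties. *)
Lemma hv_convexP (R : realType) (K : set (R * R)) : hv_convex K <->
  (forall y x1 x2 x, K (x1, y) -> K (x2, y) -> x1 <= x <= x2 -> K (x, y)) /\
  (forall x y1 y2 y, K (x, y1) -> K (x, y2) -> y1 <= y <= y2 -> K (x, y)).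
Proof.
have conv01 (u v w : R) : u < w -> u <= v <= w ->
    exists k : {i01 R}, v = k%:num * u + (1 - k%:num) * w.
  move=> uw /andP[uv vw]; have wu0 : 0 < w - u by rewrite subr_gt0.
  have k01 : 0 <= (w - v) / (w - u) <= 1.
    apply/andP; split; first by rewrite divr_ge0 ?subr_ge0// ltW.
    by rewrite ler_pdivrMr// mul1r lerD2l lerN2.
  have [k0 k1] := andP k01.
  exists (Itv01 k0 k1) => /=; field; lra.
have convE (p q : R * R) (k : {i01 R}) :
    (conv k (p : convex_lmodType (R^o * R^o)%type) q : R * R) =
    (k%:num * p.1 + (1 - k%:num) * q.1, k%:num * p.2 + (1 - k%:num) * q.2).
  by [].
have eqk (u : R) (k : {i01 R}) : k%:num * u + (1 - k%:num) * u = u by ring.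
split=> [[hc vc]|[hc vc]].
- split=> [y x1 x2 x K1 K2 /andP[le1 le2]|x y1 y2 y K1 K2 /andP[le1 le2]].
  + have [e12|lt12] := leP x2 x1; first by rewrite (_ : x = x1)//; lra.
    have [k ->] := conv01 _ _ _ lt12 (introT andP (conj le1 le2)).
    have := hc y (x1, y) (x2, y) k.
    rewrite !inE => /(_ (conj K1 erefl) (conj K2 erefl)).
    by case=> + _; rewrite convE/= eqk.
  + have [e12|lt12] := leP y2 y1; first by rewrite (_ : y = y1)//; lra.
    have [k ->] := conv01 _ _ _ lt12 (introT andP (conj le1 le2)).
    have := vc x (x, y1) (x, y2) k.
    rewrite !inE => /(_ (conj K1 erefl) (conj K2 erefl)).
    by case=> + _; rewrite convE/= eqk.
- have cvx (u v : R) (k : {i01 R}) :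
      Num.min u v <= k%:num * u + (1 - k%:num) * v <= Num.max u v.
    have k0 : 0 <= k%:num by []. have k1 : k%:num <= 1 by [].
    by case: (leP u v) => uv; apply/andP; split; nra.
  split=> [y [x1 y1] [x2 y2] k|x [x1 y1] [x2 y2] k];
      rewrite !inE => -[K1 /= e1] [K2 /= e2]; rewrite -> e1, e2 in *;
      split; rewrite /= ?convE/= eqk//.
  + have := cvx x1 x2 k; rewrite /Num.min /Num.max; case: ifP => _ xk.
    * exact: hc xk.
    * exact: hc xk.
  + have := cvx y1 y2 k; rewrite /Num.min /Num.max; case: ifP => _ xk.
    * exact: vc xk.
    * exact: vc xk.
Qed.

(** * Limits of families of sets along an ultrafilter *)

(** For an ultrafilter this is both the lower and the upper Kuratowski limit of
    the sets, since a neighbourhood that is not met almost always is almost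
    always missed. *)
Definition ultra_limit (T : topologicalType) (U : set_system (set T)) : set T :=
  [set p | forall V, nbhs p V -> \forall L \near U, L `&` V !=set0].

Section ultra_limit.
Context {R : realType} {T : topologicalType}.
Context {U : set_system (set T)} {UU : UltraFilter U}.

Lemma closed_ultra_limit : closed (ultra_limit U).
Proof.
move=> p clp V; rewrite nbhsE => -[W [oW Wp] WV].
have [q [qU Wq]] := clp W (open_nbhs_nbhs (conj oW Wp)).
have := qU W (open_nbhs_nbhs (conj oW Wq)).
by apply: filterS => L [x [Lx Wx]]; exists x; split => //; exact: WV.
Qed.

Lemma ultra_limit_sub_closed (C : set T) : closed C ->
  (\forall L \near U, L `<=` C) -> ultra_limit U `<=` C.
Proof.
move=> cC LC p pU; apply: contrapT => nCp.
have oC : open (~` C) by exact: closed_openC.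
have [L [LsubC [x [Lx nCx]]]] :=
  filter_ex (filterI LC (pU _ (open_nbhs_nbhs (conj oC nCp)))).
exact/nCx/LsubC.
Qed.

(** A point of [C] outside [O] is not in the limit, so by the ultrafilter
    property it has a neighbourhood missed by almost all [L]; finitely many
    such neighbourhoods cover the compact set [C `\` O]. *)
Lemma near_sub_open (C O : set T) : compact C -> open O ->
  (\forall L \near U, L `<=` C) -> ultra_limit U `<=` O ->
  \forall L \near U, L `<=` O.
Proof.
move=> cC oO LC UO.
have cCO : compact (C `&` ~` O).
  by apply: compact_closedI => //; exact: open_closedC.
have cov x : (C `&` ~` O) x -> \forall x' \near x & L \near U, ~ L x'.
  move=> [Cx nOx]; have nUx : ~ ultra_limit U x by move/UO.
  move/existsNP: nUx => [V /not_implyP[xV nV]].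
  have [//|UV] := in_ultra_setVsetC [set L : set T | L `&` V !=set0] UU.
  exists (V, ~` [set L : set T | L `&` V !=set0]) => //= -[y L] /= [Vy] LV Ly.
  by apply: LV; exists y.
have := (iffLR (compact_near_coveringP _)) cCO _ U (fun L x => ~ L x) _ cov.
move=> cCOU.
apply: (filterS (F := U) _ (filterI LC (cCOU _))) => L [LsubC nL] x Lx; apply: contrapT => nOx.
by apply: (nL x) => //; split => //; exact: LsubC.
Qed.

(** If the limit were empty, almost all [L] would lie in the open set [set0]. *)
Lemma ultra_limit_nonempty (C : set T) : compact C ->
  (\forall L \near U, L `<=` C) -> (\forall L \near U, L !=set0) ->
  ultra_limit U !=set0.
Proof.
move=> cC LC L0; apply: contrapT => /set0P/negP/negPn/eqP U0.
have L00 : \forall L \near U, L `<=` set0.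
  by apply: near_sub_open cC open0 LC _; rewrite U0.
by have [L [[x Lx] /(_ x Lx)]] := filter_ex (filterI L0 L00).
Qed.

(** A separation of the limit extends, by normality, to two disjoint open sets
    that cover and meet almost all [L]. *)
Lemma ultra_limit_connected (C : set T) : normal_space T -> compact C ->
  (\forall L \near U, L `<=` C) -> (\forall L \near U, connected L) ->
  connected (ultra_limit U).
Proof.
move=> nT cC LC Lcn; apply/connectedP => E [E0 UE [sep1 sep2]].
(* Both pieces are closed, hence the limit is a disjoint union of closed sets. *)
have Usub b : closure (E b) `<=` ultra_limit U.
  rewrite (closure_id (ultra_limit U)).1; last exact: closed_ultra_limit.
  by apply: closureS; rewrite UE; case: b; [right|left].
have clE b : closed (E b).
  rewrite closure_id; apply/seteqP; split; first exact: subset_closure.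
  move=> x Ebx; have := Usub _ _ Ebx; rewrite UE.
  case: b Ebx => Ex [] // Ey; exfalso.
    by have : (E false `&` closure (E true)) x by []; rewrite sep2.
  by have : (closure (E false) `&` E true) x by []; rewrite sep1.
have dE : E false `&` E true = set0.
  by rewrite -sep1 -(closure_id _).1.
have [V [W [oV oW EV EW VW]]] :=
  (iffLR (@normal_openP R T)) nT _ _ (clE false) (clE true) dE.
have UVW : ultra_limit U `<=` V `|` W.
  by rewrite UE => x [/EV|/EW]; [left|right].
have LVW := near_sub_open cC (openU oV oW) LC UVW.
have meet b (O : set T) : open O -> E b `<=` O -> \forall L \near U, L `&` O !=set0.
  move=> oO EO; have [x Ex] := E0 b.
  have : ultra_limit U x by rewrite UE; case: b Ex EO => Ex EO; [right|left].
  by apply; exact: open_nbhs_nbhs (conj oO (EO _ Ex)).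
have sepVW : separated V W.
  have disj (V' W' : set T) : open W' ->
      V' `&` W' = set0 -> closure V' `&` W' = set0.
    move=> oW' VW0; apply/seteqP; split => // z [clz W'z].
    have [w] := clz W' (open_nbhs_nbhs (conj oW' W'z)); by rewrite VW0.
  by split; [exact: disj | rewrite setIC disj// setIC].
have [L [[cL LsubVW] [[x [Lx Vx]] [y [Ly Wy]]]]] :=
  filter_ex (filterI (filterI Lcn LVW) (filterI (meet _ _ oV EV) (meet _ _ oW EW))).
have nVW z : V z -> W z -> False.
  by move=> Vz Wz; have : (V `&` W) z by []; rewrite VW.
by case: (connected_subset sepVW LsubVW cL) => sub;
  [apply: (nVW y) => //; exact: sub|apply: (nVW x) => //; exact: sub].
Qed.

End ultra_limit.

(** The other half of Hausdorff convergence: finitely many balls centred on the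
    limit cover it, and almost all [L] meet every one of them. *)
Lemma near_covered (R : realType) (T : pseudoMetricType R)
    (U : set_system (set T)) {UU : UltraFilter U} (e : R) :
    compact (ultra_limit U) -> 0 < e ->
  \forall L \near U, forall p, ultra_limit U p -> exists2 q, L q & ball p e q.
Proof.
move=> cU e0; have e20 : 0 < e / 2 by rewrite divr_gt0.
apply: ((iffLR (compact_near_coveringP _)) cU _ U
  (fun L x => exists2 q, L q & ball x e q)).
move=> x /(_ (ball x (e / 2)) (nbhsx_ballx _ _ e20)) UV.
exists (ball x (e / 2), [set L : set T | L `&` ball x (e / 2) !=set0]).
  by split => /=; [exact: nbhsx_ballx|exact: UV].
move=> [y L] /= [xy [q [Lq xq]]]; exists q => //.
by rewrite (splitr e); apply: ball_triangle xq; exact: ball_sym.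
Qed.

(** * The class of hv-convex sets is closed under ultrafilter limits *)

(** [f], [g] and [mk] are the two projections and the pairing, in either order.
    Convexity along lines alone does not pass to the limit, as the two end
    points are only approximated by points at different heights; the crossing
    lemma uses connectedness to bridge the difference. *)
Lemma ultra_limit_convex (R : realType) (T : pseudoMetricType R) (f g : T -> R)
    (mk : R -> R -> T) (U : set_system (set T)) {UU : UltraFilter U} :
    (forall a b, f (mk a b) = a) -> (forall a b, g (mk a b) = b) ->
    (forall z, mk (f z) (g z) = z) ->
    (forall a b e z, ball (mk a b) e z <-> `|a - f z| < e /\ `|b - g z| < e) ->
    continuous f -> continuous g ->
    (\forall L \near U, [/\ compact L, connected L & forall y x1 x2 x,
       L (mk x1 y) -> L (mk x2 y) -> x1 <= x <= x2 -> L (mk x y)]) ->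
  forall y x1 x2 x, ultra_limit U (mk x1 y) -> ultra_limit U (mk x2 y) ->
    x1 <= x <= x2 -> ultra_limit U (mk x y).
Proof.
move=> fmk gmk mkfg ballE fc gc LU y x1 x2 x U1 U2 /andP[].
rewrite le_eqVlt => /predU1P[<-//|x1x].
rewrite le_eqVlt => /predU1P[->//|xx2] V /nbhs_ballP[e /= e0 eV].
have d1 : 0 < Num.min e (x - x1) by rewrite lt_min e0 subr_gt0.
have d2 : 0 < Num.min e (x2 - x) by rewrite lt_min e0 subr_gt0.
apply: (filterS (F := U) _ (filterI LU
  (filterI (U1 _ (nbhsx_ballx _ _ d1)) (U2 _ (nbhsx_ballx _ _ d2))))) => L.
move=> [[Lco Lcn Lcv] [[p [Lp /ballE[fp gp]]] [q [Lq /ballE[fq gq]]]]].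
move: fp gp fq gq; rewrite !lt_min.
move=> /andP[_ fp] /andP[gp _] /andP[_ fq] /andP[gq _].
have fpx : f p <= x <= f q by move: fp fq; rewrite !ltr_norml; lra.
have Lcv' u v : L u -> L v -> g u = g v -> f u <= x <= f v ->
    exists w, [/\ L w, f w = x & g w = g u].
  move=> Lu Lv guv fuv; exists (mk x (g u)); rewrite fmk gmk; split=> //.
  by apply: (Lcv _ (f u) (f v)) => //; rewrite ?mkfg// guv mkfg.
have [w [Lw fw gw]] := connected_crossing fc gc Lco Lcn Lcv' Lp Lq fpx.
exists w; split => //; apply: eV; apply/ballE; split.
  by rewrite fw subrr normr0.
move: gw gp gq; rewrite /Num.min /Num.max !ltr_norml.
by case: ifP => _; lra.
Qed.

Lemma closed_box (R : realType) (a b c d : R) : closed (box a b c d).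
Proof.
rewrite /box (_ : _ `*` _ = (fst @^-1` `[a, b]) `&` (snd @^-1` `[c, d])) //.
by apply: closedI; apply: preimage_closed => //; try exact: itv_closed;
  move=> ? _; [exact: cvg_fst|exact: cvg_snd].
Qed.

Lemma compact_box (R : realType) (a b c d : R) : compact (box a b c d).
Proof. by apply: compact_setX; exact: segment_compact. Qed.

Lemma bounding_box_sub_box (R : realType) (a b c d : R) (A : set (R * R)) :
  a <= b -> c <= d -> bounding_box A `<=` box a b c d <-> A `<=` box a b c d.
Proof.
move=> ab cd; split=> Asub p Ap; last by apply: Ap; split => //; exists a, b, c, d.
by apply: Asub => D [_]; exact.
Qed.

Section hv_limit.
Context {R : realType} {a b c d : R} {U : set_system (set (R * R))}.
Context {UU : UltraFilter U}.
Hypotheses (ab : a < b) (cd : c < d).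
Hypothesis UB : \forall L \near U, hv_class (box a b c d) L.

Lemma near_sub_box : \forall L \near U, L `<=` box a b c d.
Proof.
apply: (filterS (F := U) _ UB) => L [_ _ _ _].
by move/(bounding_box_sub_box _ (ltW ab) (ltW cd)).
Qed.

Lemma ultra_limit_compact : compact (ultra_limit U).
Proof.
apply: (subclosed_compact _ (@compact_box R a b c d)).
  exact: closed_ultra_limit.
by apply: (ultra_limit_sub_closed _ near_sub_box); exact: closed_box.
Qed.

Lemma ultra_limit_hv_class : hv_class (box a b c d) (ultra_limit U).
Proof.
split.
- apply: (ultra_limit_nonempty (@compact_box R a b c d) near_sub_box).
  by apply: (filterS (F := U) _ UB) => L [].
- exact: ultra_limit_compact.
- apply: (@ultra_limit_connected R _ _ _ (box a b c d)); last 2 first.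
  + exact: near_sub_box.
  + by apply: (filterS (F := U) _ UB) => L [].
  + exact: (@pseudometric_normal R).
  + exact: (@compact_box R).
- apply/hv_convexP; split.
  + apply: (ultra_limit_convex (f := fst) (g := snd) (mk := pair)) => //.
    * by move=> [].
    * by move=> x; exact: cvg_fst.
    * by move=> x; exact: cvg_snd.
    * apply: (filterS (F := U) _ UB) => L [_ Lco Lcn /hv_convexP[Lh _] _].
      by split.
  + apply: (ultra_limit_convex (f := snd) (g := fst)
      (mk := fun u v => (v, u))) => //.
    * by move=> [].
    * by move=> u v e z; split => -[].
    * by move=> x; exact: cvg_snd.
    * by move=> x; exact: cvg_fst.
    * apply: (filterS (F := U) _ UB) => L [_ Lco Lcn /hv_convexP[_ Lv] _].
      by split.
- apply/(bounding_box_sub_box _ (ltW ab) (ltW cd)).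
  by apply: (ultra_limit_sub_closed _ near_sub_box); exact: closed_box.
Qed.

End hv_limit.

(** [s] and [t] are the signs of the quadrant: [true] means left, resp. below. *)
Definition quadrant_meets (R : realType) (e : R) (s t : bool)
    (L : set (R * R)) : set (R * R) :=
  [set p | exists q, [/\ L q,
    e < (-1) ^+ s * (q.1 - p.1) & e < (-1) ^+ t * (q.2 - p.2)]].

Definition core (R : realType) (e : R) (L : set (R * R)) : set (R * R) :=
  [set p | forall s t : bool, quadrant_meets e s t L p].

(** The crossing lemma applied to points in the two upper quadrants gives a point
    of [L] straight above [p], and likewise below; vertical convexity
    concludes. *)
Lemma core_sub (R : realType) (L : set (R * R)) :
  compact L -> connected L -> hv_convex L -> core 0 L `<=` L.
Proof.
move=> Lco Lcn /hv_convexP[Lh Lv] p pL.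
have cross (t : bool) : exists w, [/\ L w, w.1 = p.1 & 0 < (-1) ^+ t * (w.2 - p.2)].
  have [q [Lq q1 q2]] := pL true t; have [r [Lr r1 r2]] := pL false t.
  have cvx u v : L u -> L v -> u.2 = v.2 -> u.1 <= p.1 <= v.1 ->
      exists w, [/\ L w, w.1 = p.1 & w.2 = u.2].
    move=> Lu Lv' uv upv; exists (p.1, u.2); split => //=.
    apply: (Lh u.2 u.1 v.1) => //; first by rewrite -surjective_pairing.
    by rewrite uv -surjective_pairing.
  have qpr : q.1 <= p.1 <= r.1 by move: q1 r1 => /=; rewrite expr1 expr0; lra.
  have [w [Lw wp wq]] := @connected_crossing R _ fst snd L p.1 q r
    (fun=> cvg_fst) (fun=> cvg_snd) Lco Lcn cvx Lq Lr qpr.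
  exists w; split => //; move: wq q2 r2; rewrite /Num.min /Num.max.
  by case: t {q1 r1} ; case: ifP => _; rewrite /= ?expr1 ?expr0; lra.
have [u [Lu u1 u2]] := cross true; have [v [Lv' v1 v2]] := cross false.
rewrite [p]surjective_pairing; apply: (Lv _ u.2 v.2).
- by rewrite -u1 -surjective_pairing.
- by rewrite -v1 -surjective_pairing.
- by move: u2 v2 => /=; rewrite expr1 expr0; lra.
Qed.

(** This is why the quadrants are pushed away by [e]: moving a point by less
    than [e] keeps it in the open quadrant. *)
Lemma core_approx (R : realType) (e : R) (K L : set (R * R)) :
  (forall p, K p -> exists2 q, L q & ball p e q) -> core e K `<=` core 0 L.
Proof.
move=> KL p pK s t; have [q [Kq q1 q2]] := pK s t.
have [r Lr [qr1 qr2]] := KL q Kq; exists r; split => //.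
- move: q1 qr1; rewrite /ball/= ltr_norml.
  by case: s; rewrite /= ?expr1 ?expr0; lra.
- move: q2 qr2; rewrite /ball/= ltr_norml.
  by case: t; rewrite /= ?expr1 ?expr0; lra.
Qed.

(** * Null boundaries *)

Local Notation plane R := (measurableTypeR R * measurableTypeR R)%type.

(** The product sigma-algebra contains the open sets of the plane because the
    plane has a countable base of squares. *)
Lemma open_measurable_plane (R : realType) (O : set (R * R)) : open O ->
  measurable (O : set (plane R)).
Proof.
move=> oO.
(* A square that is not inside [O] is replaced by the empty set, so that the
   union may run over all indices. *)
pose sq (i : rat * rat * nat) : set (R * R) :=
  ball (ratr i.1.1 : R) i.2.+1%:R^-1 `*` ball (ratr i.1.2 : R) i.2.+1%:R^-1.
pose F i := if `[< sq i `<=` O >] then sq i else set0.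
have -> : O = \bigcup_i F i.
  apply/seteqP; split => [p Op|p [i _]]; last first.
    by rewrite /F; case: asboolP => // iO /iO.
  have [e /= e0 eO] := (iffLR (nbhs_ballP _ _)) (open_nbhs_nbhs (conj oO Op)).
  have [n n0] : exists n : nat, n.+1%:R^-1 < e / 2.
    have e20 : 0 < e / 2 by rewrite divr_gt0.
    have [n _ /(_ n (leqnn n))] := near_infty_natSinv_lt (PosNum e20).
    by exists n.
  have near_rat (x : R) : exists q : rat, `|ratr q - x| < n.+1%:R^-1.
    have [|q] := @rat_in_itvoo R (x - n.+1%:R^-1) (x + n.+1%:R^-1).
      by rewrite ltrBlDr -addrA ltrDl addr_gt0.
    rewrite in_itv /= => /andP[qx1 qx2]; exists q.
    by rewrite ltr_norml; move: qx1 qx2; move: (n.+1%:R^-1 : R) => k; lra.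
  have [q1 q1p] := near_rat p.1; have [q2 q2p] := near_rat p.2.
  have sqp : sq (q1, q2, n) p by split.
  exists (q1, q2, n) => //; rewrite /F; case: asboolP => // -[] u [u1 u2].
  apply: eO; move: u1 u2 q1p q2p; rewrite /ball /= => u1 u2 q1p q2p.
  split; rewrite /ball/=; move: u1 u2 q1p q2p n0; rewrite !ltr_norml /=;
    move: (n.+1%:R^-1 : R) => k; lra.
apply: countable_bigcupT_measurable; first exact: countableP.
move=> i; rewrite /F; case: asboolP => // _.
by apply: measurableX; exact: measurable_ball.
Qed.

Lemma closed_measurable_plane (R : realType) (C : set (R * R)) : closed C ->
  measurable (C : set (plane R)).
Proof.
move=> cC; rewrite -[C]setCK; apply: measurableC.
by apply: open_measurable_plane; exact: closed_openC.
Qed.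

(** The sign [s] selects nonincreasing or nondecreasing relations; vertical
    sections with several points are allowed.  A rational strictly between two
    points of the section at [x] cannot lie strictly between two points of the
    section at another abscissa, so only countably many sections have several
    points and Fubini's theorem applies. *)
Lemma monotone_relation_null (R : realType) (s : bool) (Z : set (R * R)) :
    measurable (Z : set (plane R)) ->
    (forall p q, Z p -> Z q -> p.1 < q.1 -> (-1) ^+ s * (q.2 - p.2) <= 0) ->
  lebesgue2 Z = 0%E.
Proof.
move=> mZ Zmon.
pose S (r : rat) := [set x : R |
  exists y z : R, [/\ Z (x, y), Z (x, z) & y < ratr r < z]].
(* [S r] is the set of abscissas whose section has points on both sides of
   the rational [r]. *)
have S1 r x x' : S r x -> S r x' -> x < x' -> False.
  move=> [y [z [Zy Zz yz]]] [y' [z' [Zy' Zz' yz']]] xx'.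
  have := Zmon _ _ Zy Zz' xx'; have := Zmon _ _ Zz Zy' xx'.
  by case: s {Zmon}; rewrite /= ?expr1 ?expr0; lra.
have cS : countable (\bigcup_r S r).
  apply: bigcup_countable => // r _.
  apply: (@sub_countable _ _ _ [set xget 0 (S r)]); last exact: countable1.
  apply: subset_card_le => x Sx /=.
  have Sg : S r (xget 0 (S r)) by apply: xgetI Sx.
  by have [/(S1 _ _ _ Sx Sg)|/(S1 _ _ _ Sg Sx)|] := ltgtP x (xget 0 (S r)).
rewrite /lebesgue2 /= /product_measure1.
rewrite (@ge0_ae_eq_integral _ _ _ _ _ _ (cst 0%E)) ?integral0//.
- exact: measurable_fun_xsection.
- exists (\bigcup_r S r); split => //.
  + exact: countable_measurable.
  + exact: countable_lebesgue_measure0.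
  + move=> x /= /not_implyP[_ nx]; apply: contrapT => nSx; apply: nx.
    suff [y sy] : exists y, xsection Z x `<=` [set y].
      apply/eqP; rewrite -measure_le0 -(lebesgue_measure_set1 y).
      by apply: le_measure => //; rewrite inE//; exact: measurable_xsection.
    exists (xget 0 (xsection Z x)) => y Zy /=.
    have Zg : xsection Z x (xget 0 (xsection Z x)) by apply: xgetI Zy.
    have sep u v : xsection Z x u -> xsection Z x v -> u < v -> False.
      move=> /xsectionP Zu /xsectionP Zv uv.
      have [q] := rat_in_itvoo uv; rewrite in_itv/= => uqv.
      by apply: nSx; exists q => //; exists u, v.
    by have [/(sep _ _ Zy Zg)|/(sep _ _ Zg Zy)|] := ltgtP y (xget 0 (xsection Z x)).
Qed.

Lemma open_quadrant_meets (R : realType) (e : R) s t (L : set (R * R)) :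
  open (quadrant_meets e s t L).
Proof.
rewrite openE => p [q [Lq q1 q2]].
pose d := Num.min ((-1) ^+ s * (q.1 - p.1) - e) ((-1) ^+ t * (q.2 - p.2) - e).
have d0 : 0 < d by rewrite lt_min !subr_gt0 q1.
apply/nbhs_ballP; exists d => //= r [r1 r2]; exists q; split => //.
- move: q1 r1; rewrite /ball/= lt_min !ltr_norml => q1 /andP[+ _].
  by case: s {d d0 r2} q1; rewrite /= ?expr1 ?expr0; lra.
- move: q2 r2; rewrite /ball/= lt_min !ltr_norml => q2 /andP[_ +].
  by case: t {d d0 r1} q2; rewrite /= ?expr1 ?expr0; lra.
Qed.

Lemma coreE (R : realType) (e : R) (L : set (R * R)) :
  core e L = quadrant_meets e true true L `&` quadrant_meets e true false L `&`
    (quadrant_meets e false true L `&` quadrant_meets e false false L).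
Proof.
apply/seteqP; split => p; first by move=> pL; do !split; exact: pL.
by move=> [[? ?] [? ?]] [] [].
Qed.

Lemma open_core (R : realType) (e : R) (L : set (R * R)) : open (core e L).
Proof. by rewrite coreE; do !apply: openI; exact: open_quadrant_meets. Qed.

Definition nbh (R : realType) (e : R) (L : set (R * R)) : set (R * R) :=
  [set p | exists2 q, L q & ball q e p].

Lemma open_nbh (R : realType) (e : R) (L : set (R * R)) : 0 < e -> open (nbh e L).
Proof.
move=> e0; rewrite (_ : nbh e L = \bigcup_(q in L) ball q e)//.
by apply: bigcup_open => q _; exact: ball_open.
Qed.

(** If the north-east quadrants at points of a set [Z] all miss [Z], then [Z]
    is a nonincreasing relation, and similarly for the other quadrants. *)
Lemma core_null (R : realType) (L : set (R * R)) : closed L ->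
  lebesgue2 (L `\` core 0 L) = 0%E.
Proof.
move=> cL; have mL := closed_measurable_plane cL.
have Z0 s t : (@lebesgue2 R).-negligible (L `\` quadrant_meets 0 s t L).
  have mZ : measurable (L `\` quadrant_meets 0 s t L : set (plane R)).
    apply: measurableD => //; apply: open_measurable_plane; exact: open_quadrant_meets.
  apply/negligibleP => //.
  (* Equal signs give nonincreasing relations, opposite signs nondecreasing
     ones. *)
  apply: (@monotone_relation_null _ (s (+) t)) => //.
  move=> p q [Lp np] [Lq nq] pq; rewrite leNgt; apply/negP => pqt.
  case: s {mZ} np nq pqt => /= np nq pqt.
  - apply: nq; exists p; split => //; first by rewrite expr1; lra.
    by case: t np pqt => /=; rewrite ?expr1 ?expr0; lra.
  - by apply: np; exists q; split => //; rewrite expr0; lra.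
have mcore : measurable (L `\` core 0 L : set (plane R)).
  by apply: measurableD => //; apply: open_measurable_plane; exact: open_core.
apply/negligibleP => //; rewrite coreE !setDIr.
by do !apply: negligibleU; exact: Z0.
Qed.

Lemma lebesgue2_box (R : realType) (a b c d : R) : a <= b -> c <= d ->
  lebesgue2 (box a b c d) = ((b - a) * (d - c))%:E.
Proof.
move=> ab cd.
transitivity
  (lebesgue_measure `[a, b]%classic * lebesgue_measure `[c, d]%classic : \bar R)%E.
  by apply: product_measure1E; exact: measurable_itv.
rewrite !lebesgue_measure_itv/= !lte_fin.
have := ab; have := cd; rewrite !le_eqVlt.
move=> /predU1P[->|->] /predU1P[->|->];
  by rewrite ?ltxx ?subrr ?mul0e ?mule0 ?mul0r ?mulr0 -?EFinD -?EFinM.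
Qed.

(** Continuity from above: the intersection of these sets over [e] is contained
    in the null set [L `\` core 0 L]. *)
Lemma nbh_core_small (R : realType) (a b c d : R) (L : set (R * R)) (eta : R) :
  a <= b -> c <= d -> closed L -> 0 < eta ->
  exists2 e, 0 < e &
    (lebesgue2 ((box a b c d `&` nbh e L) `\` core e L) < eta%:E)%E.
Proof.
move=> ab cd cL eta0.
pose e_ (n : nat) : R := n.+1%:R^-1.
have e0 n : 0 < e_ n by rewrite invr_gt0.
have e_lt (r : R) : 0 < r -> exists n, e_ n < r.
  move=> r0; have [n _ /(_ n (leqnn n))] := near_infty_natSinv_lt (PosNum r0).
  by exists n.
have e_mono m n : (m <= n)%N -> e_ n <= e_ m.
  by move=> mn; rewrite /e_ lef_pV2 ?posrE// ler_nat.
pose F n := (box a b c d `&` nbh (e_ n) L) `\` core (e_ n) L.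
have mF n : measurable (F n : set (plane R)).
  apply: measurableD; last by apply: open_measurable_plane; exact: open_core.
  apply: measurableI; first by apply: closed_measurable_plane; exact: closed_box.
  by apply: open_measurable_plane; exact: open_nbh.
have F0 : lebesgue2 (\bigcap_n F n) = 0%E.
  apply/eqP; rewrite -measure_le0 -(core_null cL).
  apply: le_measure; rewrite ?inE.
  - exact: bigcapT_measurable.
  - apply: measurableD; first exact: closed_measurable_plane.
    by apply: open_measurable_plane; exact: open_core.
  - move=> p Fp; split.
      apply: cL => V /nbhs_ballP[r /= r0 rV].
      have [n nr] := e_lt r r0; have [[_ [q Lq qp]] _] := Fp n I.
      exists q; split => //; apply: rV; apply: ball_sym.
      exact: (le_ball (ltW nr)).
    move=> pc.
    have qn s t : exists n, forall m, (n <= m)%N -> quadrant_meets (e_ m) s t L p.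
      have [q [Lq q1 q2]] := pc s t.
      have [|n] := e_lt (Num.min
        ((-1) ^+ s * (q.1 - p.1)) ((-1) ^+ t * (q.2 - p.2))).
        by rewrite lt_min q1.
      rewrite lt_min => /andP[nq1 nq2]; exists n => m nm; exists q; split => //.
        exact: le_lt_trans (e_mono _ _ nm) nq1.
      exact: le_lt_trans (e_mono _ _ nm) nq2.
    have [n1 h1] := qn true true; have [n2 h2] := qn true false.
    have [n3 h3] := qn false true; have [n4 h4] := qn false false.
    (* One radius small enough for all four quadrants. *)
    pose n := maxn (maxn n1 n2) (maxn n3 n4).
    have [_] := Fp n I; apply; rewrite coreE; do !split.
    - by apply: h1; rewrite !leq_max leqnn.
    - by apply: h2; rewrite !leq_max leqnn orbT.
    - by apply: h3; rewrite !leq_max leqnn orbT.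
    - by apply: h4; rewrite !leq_max leqnn !orbT.
have Fcvg : (lebesgue2 \o F) x @[x --> \oo] --> 0%E.
  rewrite -F0; apply: nonincreasing_cvg_mu => //.
  - apply: (@le_lt_trans _ _ (lebesgue2 (box a b c d))); last first.
      by rewrite lebesgue2_box// ltry.
    apply: le_measure; rewrite ?inE//.
      by apply: closed_measurable_plane; exact: closed_box.
    by move=> p [[]].
  - exact: bigcapT_measurable.
  - move=> m n mn; apply/subsetPset => p [[pB [q Lq qp]] nc]; split.
      by split => //; exists q => //; exact: le_ball (e_mono _ _ mn) _ qp.
    move=> pc; apply: nc => s t; have [r [Lr r1 r2]] := pc s t.
    exists r; split => //.
      exact: le_lt_trans (e_mono _ _ mn) r1.
    exact: le_lt_trans (e_mono _ _ mn) r2.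
have := Fcvg _ (@open_ereal_lt' _ 0%E eta%:E _).
rewrite lte_fin => /(_ eta0)[n _ /(_ n (leqnn n)) Fn].
by exists (e_ n).
Qed.

(** * Estimates for conic functions *)

Section integrals_over_box.
Context {R : realType} {a b c d : R}.
Hypotheses (ab : a <= b) (cd : c <= d).
Local Notation B := (box a b c d).
Local Notation mu := (@lebesgue2 R).
Implicit Types (D K S N C : set (plane R)).

Lemma measurable_box : measurable (B : set (plane R)).
Proof. by apply: closed_measurable_plane; exact: closed_box. Qed.

Lemma lebesgue2_sub_box D : measurable D -> D `<=` B -> (mu D < +oo)%E.
Proof.
move=> mD DB; apply: (@le_lt_trans _ _ (mu B)); last first.
  by rewrite lebesgue2_box// ltry.
by apply: le_measure; rewrite ?inE//; exact: measurable_box.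
Qed.

Lemma fin_num_sub_box D : measurable D -> D `<=` B -> mu D \is a fin_num.
Proof. by move=> mD DB; rewrite ge0_fin_numE//; exact: lebesgue2_sub_box. Qed.

Lemma integrable_box D (f : plane R -> R) (M : R) : measurable D -> D `<=` B ->
  measurable_fun setT f -> (forall q, B q -> `|f q| <= M) ->
  mu.-integrable D (EFin \o f).
Proof.
move=> mD DB mf fM; apply: measurable_bounded_integrable => //.
- exact: lebesgue2_sub_box.
- exact: measurable_funS mf.
- exists M; split; first exact: num_real.
  by move=> M' MM' q Dq; apply: le_trans (ltW MM'); apply: fM; exact: DB.
Qed.

Lemma measurable_abs_sub (x : R) (g : plane R -> R) :
  measurable_fun setT g -> measurable_fun setT (fun q => `|x - g q|).
Proof.
by move=> mg; apply: measurableT_comp => //; exact: measurable_funB.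
Qed.

Lemma abs_sub_fst_bound (x : R) (q : R * R) : B q ->
  `|x - q.1| <= `|x| + `|a| + `|b|.
Proof.
case=> /=; rewrite in_itv/= => q1 _.
by do 4 (case: ler0P => ?); lra.
Qed.

Lemma abs_sub_snd_bound (x : R) (q : R * R) : B q ->
  `|x - q.2| <= `|x| + `|c| + `|d|.
Proof.
case=> /= _; rewrite in_itv/= => q1.
by do 4 (case: ler0P => ?); lra.
Qed.

Lemma integrable_abs_fst D (x : R) : measurable D -> D `<=` B ->
  mu.-integrable D (EFin \o (fun q => `|x - q.1|)).
Proof.
move=> mD DB; apply: (integrable_box mD DB) => [|q Bq].
  by apply: measurable_abs_sub; exact: measurable_fst.
by rewrite normr_id; exact: abs_sub_fst_bound Bq.
Qed.

Lemma integrable_abs_snd D (x : R) : measurable D -> D `<=` B ->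
  mu.-integrable D (EFin \o (fun q => `|x - q.2|)).
Proof.
move=> mD DB; apply: (integrable_box mD DB) => [|q Bq].
  by apply: measurable_abs_sub; exact: measurable_snd.
by rewrite normr_id; exact: abs_sub_snd_bound Bq.
Qed.

Lemma conic_funE K p : measurable K -> K `<=` B ->
  conic_fun K p = \int[mu]_(q in K) `|p.1 - q.1| + \int[mu]_(q in K) `|p.2 - q.2|.
Proof.
move=> mK KB; rewrite /conic_fun RintegralD//.
- exact: integrable_abs_fst.
- exact: integrable_abs_snd.
Qed.

Lemma integrable_conic D p : measurable D -> D `<=` B ->
  mu.-integrable D (EFin \o (fun q => `|p.1 - q.1| + `|p.2 - q.2|)).
Proof.
move=> mD DB.
apply: (integrable_box
  (M := `|p.1| + `|a| + `|b| + (`|p.2| + `|c| + `|d|)) mD DB) => [|q Bq].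
  by apply: measurable_funD; apply: measurable_abs_sub;
    [exact: measurable_fst|exact: measurable_snd].
rewrite ger0_norm ?addr_ge0//.
by apply: lerD; [exact: abs_sub_fst_bound|exact: abs_sub_snd_bound].
Qed.

(** Both integrals exceed the one over [C] by at most the integral over the gap
    [N `\` C], on which the integrand is at most the semiperimeter of the
    box. *)
Lemma conic_fun_close C S S' N p :
  measurable C -> measurable S -> measurable S' -> measurable N ->
  C `<=` S -> C `<=` S' -> S `<=` N -> S' `<=` N -> N `<=` B -> B p ->
  `|conic_fun S p - conic_fun S' p| <= ((b - a) + (d - c)) * fine (mu (N `\` C)).
Proof.
move=> mC mS mS' mN CS CS' SN SN' NB Bp.
set M := (b - a) + (d - c).
have gM q : B q -> `|p.1 - q.1| + `|p.2 - q.2| <= M.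
  move: Bp => [/=]; rewrite !in_itv/= => p1 p2 [/=]; rewrite !in_itv/= => q1 q2.
  by rewrite /M; do 2 (case: ler0P => ?); lra.
have key T : measurable T -> C `<=` T -> T `<=` N ->
    conic_fun C p <= conic_fun T p <= conic_fun C p + M * fine (mu (N `\` C)).
  move=> mT CT TN.
  have TB := subset_trans TN NB.
  have -> : conic_fun T p = conic_fun C p + conic_fun (T `\` C) p.
    rewrite /conic_fun -Rintegral_setU ?setDUK//.
    - exact: measurableD.
    - exact: integrable_conic.
    - by rewrite disj_set2E setDIK.
  have mTC : measurable (T `\` C) by exact: measurableD.
  have TCB : T `\` C `<=` B by move=> q [/TB].
  rewrite lerDl; apply/andP; split.
    by apply: Rintegral_ge0 => q _; rewrite addr_ge0.
  rewrite lerD2l; apply: (@le_trans _ _ (\int[mu]_(q in T `\` C) M)).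
    apply: le_Rintegral => //.
    - exact: integrable_conic.
    - by apply: (integrable_box (M := `|M|) mTC TCB) => //; exact: measurable_cst.
    - by move=> q /TCB/gM.
  rewrite Rintegral_cst//; apply: ler_wpM2l; first by rewrite addr_ge0 ?subr_ge0.
  apply: fine_le.
  - exact: fin_num_sub_box.
  - by apply: fin_num_sub_box; [exact: measurableD|move=> q [/NB]].
  - apply: le_measure; rewrite ?inE//; first exact: measurableD.
    exact: setSD.
have := key S mS CS SN; have := key S' mS' CS' SN'.
by rewrite ler_norml; lra.
Qed.

Lemma conic_fun_lipschitz K p p' : measurable K -> K `<=` B ->
  `|conic_fun K p - conic_fun K p'| <=
    (`|p.1 - p'.1| + `|p.2 - p'.2|) * fine (mu K).
Proof.
move=> mK KB; rewrite /conic_fun -RintegralB//; try exact: integrable_conic.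
have mg r : measurable_fun setT (fun q : plane R => `|r.1 - q.1| + `|r.2 - q.2|).
  by apply: measurable_funD; apply: measurable_abs_sub;
    [exact: measurable_fst|exact: measurable_snd].
have dM q : `| `|p.1 - q.1| + `|p.2 - q.2| - (`|p'.1 - q.1| + `|p'.2 - q.2|)| <=
    `|p.1 - p'.1| + `|p.2 - p'.2|.
  rewrite opprD addrACA (le_trans (ler_normD _ _))// lerD//.
    by rewrite (le_trans (ler_dist_dist _ _))// (_ : _ - _ = p.1 - p'.1)//; ring.
  by rewrite (le_trans (ler_dist_dist _ _))// (_ : _ - _ = p.2 - p'.2)//; ring.
apply: (le_trans (le_normr_Rintegral _ _)) => //.
  by apply: (integrable_box mK KB) => [|q _]; [exact: measurable_funB|exact: dM].
rewrite -Rintegral_cst//; apply: le_Rintegral => //.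
- apply: (integrable_box mK KB) => [|q _]; last by rewrite normr_id; exact: dM.
  by apply: measurableT_comp => //; exact: measurable_funB.
- apply: (integrable_box (M := `| `|p.1 - p'.1| + `|p.2 - p'.2| |) mK KB) => //.
Qed.

End integrals_over_box.

(** * Recovering the mass distribution of a coordinate *)

Lemma close_slopes (R : realFieldType) (I J C h s t : R) : 0 < h ->
  `|I - J - h * s| <= C -> `|I - J - h * t| <= C -> h * `|s - t| <= 2 * C.
Proof.
move=> h0 sC tC; rewrite -[h in h * _]gtr0_norm// -normrM.
rewrite (_ : h * (s - t) = (I - J - h * t) - (I - J - h * s)); last by ring.
rewrite (le_trans (ler_normB _ _))//; lra.
Qed.

(** The algebra of [abs_increment]: [m1], [m2], [m3] are the masses of the parts
    of [K] before, inside and after the slab between [x] and [x + h], and [i]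
    is the contribution of the middle part. *)
Lemma increment_error (R : realFieldType) (h m1 m2 m3 i W : R) : 0 < h ->
  0 <= m2 -> `|i| <= h * m2 -> m2 <= W * h ->
  `|h * m1 + i + - h * m3 - h * (2 * m1 - (m1 + m2 + m3))| <= 2 * W * h ^+ 2.
Proof.
move=> h0 m0 im mW.
rewrite (_ : _ - _ = i + h * m2); last by ring.
rewrite (le_trans (ler_normD _ _))// [`|h * m2|]ger0_norm; last first.
  exact: mulr_ge0 (ltW h0) m0.
have := ler_wpM2l (ltW h0) mW; rewrite expr2; lra.
Qed.

Section coordinate_mass.
Context {R : realType} {a b c d : R}.
Hypotheses (ab : a <= b) (cd : c <= d).
Local Notation B := (box a b c d).
Local Notation mu := (@lebesgue2 R).
Variable g : plane R -> R.
Hypothesis mg : measurable_fun setT g.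
Variables (u v W : R).
Hypothesis W0 : 0 < W.
Hypothesis uv : u < v.
Hypothesis gB : forall q, B q -> u <= g q <= v.
Hypothesis g_strip : forall x h : R, 0 < h ->
  (mu (B `&` g @^-1` `]x, (x + h)%R[) <= (W * h)%:E)%E.
Hypothesis g_edge : mu (B `&` g @^-1` `]-oo, u]) = 0%E.
Implicit Types K L : set (plane R).

(** Its measure, as a function of [x], is the cumulative distribution function
    of the coordinate [g] on [K]. *)
Definition mass_le K (x : R) : set (plane R) := K `&` g @^-1` `]-oo, x].

Lemma measurable_slab (P : set R) K :
  measurable K -> measurable (P : set (measurableTypeR R)) ->
  measurable (K `&` g @^-1` P).
Proof.
move=> mK mP; apply: measurableI => //.
by rewrite -[X in measurable X]setTI; exact: mg.
Qed.

Let integrable_abs D (x : R) : measurable D -> D `<=` B ->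
  mu.-integrable D (EFin \o (fun q => `|x - g q|)).
Proof.
move=> mD DB.
apply: (integrable_box (M := `|x| + `|u| + `|v|) ab cd mD DB) => [|q Bq].
  exact: measurable_abs_sub.
rewrite normr_id; have := gB Bq.
by do 4 (case: ler0P => ?); lra.
Qed.

(** The integrand [|x + h - g| - |x - g|] is [h] where [g <= x] and [- h] where
    [x + h <= g]; the slab in between has mass at most [W * h].  So the
    right derivative of the integral is the mass before [x] minus the mass
    after [x], with a uniform quadratic error. *)
Lemma abs_increment K x h : measurable K -> K `<=` B -> 0 < h ->
  `|\int[mu]_(q in K) `|x + h - g q| - \int[mu]_(q in K) `|x - g q| -
    h * (2 * fine (mu (mass_le K x)) - fine (mu K))| <= 2 * W * h ^+ 2.
Proof.
move=> mK KB h0.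
pose K1 := mass_le K x.
pose K2 := K `&` g @^-1` `]x, (x + h)[.
pose K3 := K `&` g @^-1` `[x + h, +oo[.
have mK1 : measurable K1 by apply: measurable_slab => //; exact: measurable_itv.
have mK2 : measurable K2 by apply: measurable_slab => //; exact: measurable_itv.
have mK3 : measurable K3 by apply: measurable_slab => //; exact: measurable_itv.
have in1 q : K1 q -> g q <= x by case=> _ /=; rewrite in_itv.
have in2 q : K2 q -> x < g q < x + h by case=> _ /=; rewrite in_itv.
have in3 q : K3 q -> x + h <= g q by case=> _ /=; rewrite in_itv/= andbT.
have KE : K = (K1 `|` K2) `|` K3.
  apply/seteqP; split => [q Kq|q [[[]|[]]|[]]]//.
  case: (leP (g q) x) => gx; first by left; left; split => //=; rewrite in_itv.
  case: (leP (x + h) (g q)) => gxh; [right|left; right];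
    split => //=; rewrite in_itv/=.
    by rewrite gxh.
  by rewrite gx.
have d12 : [disjoint K1 & K2].
  by rewrite disj_set2E; apply/eqP/seteqP; split => // q [/in1 q1 /in2 q2]; lra.
have d123 : [disjoint K1 `|` K2 & K3].
  rewrite disj_set2E; apply/eqP/seteqP; split => // q [q12 /in3 q3].
  by case: q12 => [/in1|/in2]; lra.
have sub1 : K1 `<=` B by move=> q [/KB].
have sub2 : K2 `<=` B by move=> q [/KB].
have sub3 : K3 `<=` B by move=> q [/KB].
rewrite -RintegralB//; try exact: integrable_abs.
pose F q := `|x + h - g q| - `|x - g q|.
have iF D : measurable D -> D `<=` B -> mu.-integrable D (EFin \o F).
  move=> mD DB.
  apply: (integrable_box (M := h) ab cd mD DB) => [|q _].
    by apply: measurable_funB; exact: measurable_abs_sub.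
  by rewrite /F; do 3 (case: ler0P => ?); lra.
have -> : \int[mu]_(q in K) (`|x + h - g q| - `|x - g q|) =
    h * fine (mu K1) + \int[mu]_(q in K2) F q + - h * fine (mu K3).
  rewrite {1}KE Rintegral_setU//; last 2 first.
  - exact: measurableU.
  - by rewrite -KE; exact: iF.
  rewrite Rintegral_setU//; last by apply: iF; [exact: measurableU|rewrite subUset].
  rewrite -!Rintegral_cst//; congr (_ + _ + _);
    apply: eq_Rintegral => q; rewrite inE /F.
    by move=> /in1; do 2 (case: ler0P => ?); lra.
  by move=> /in3; do 2 (case: ler0P => ?); lra.
have fin D : measurable D -> D `<=` B -> mu D \is a fin_num.
  exact: fin_num_sub_box.
have -> : fine (mu K) = fine (mu K1) + fine (mu K2) + fine (mu K3).
  have mu12 : (mu (K1 `|` K2) = mu K1 + mu K2)%E.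
    by apply: measureU => //; apply/eqP; rewrite -disj_set2E.
  have -> : (mu K = mu K1 + mu K2 + mu K3)%E.
    rewrite -mu12 {1}KE; apply: measureU => //; first exact: measurableU.
    by apply/eqP; rewrite -disj_set2E.
  have f1 := fin _ mK1 sub1; have f2 := fin _ mK2 sub2; have f3 := fin _ mK3 sub3.
  move: f1 f2 f3; move: (mu K1) (mu K2) (mu K3) => [?||] [?||] [?||] //.
have F2 : `|\int[mu]_(q in K2) F q| <= h * fine (mu K2).
  rewrite (le_trans (le_normr_Rintegral _ _))//; first exact: iF.
  rewrite -Rintegral_cst//; apply: le_Rintegral => //.
  - have := iF _ mK2 sub2; exact: integrable_norm.
  - by apply: (integrable_box (M := `|h|) ab cd mK2 sub2).
  - by move=> q _; rewrite /F; do 3 (case: ler0P => ?); lra.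
have W2 : fine (mu K2) <= W * h.
  rewrite -lee_fin fineK ?fin//; apply: le_trans (g_strip x h0).
  apply: le_measure; rewrite ?inE//.
    by apply: measurable_slab; [exact: measurable_box|exact: measurable_itv].
  by move=> q [/KB].
have m0 : 0 <= fine (mu K2) by exact: fine_ge0.
exact: (increment_error (fine (mu K1)) (fine (mu K3)) h0 m0 F2 W2).
Qed.

(** The estimate [abs_increment] for [h] tending to 0 identifies
    [2 * mass before x - total mass] for [u <= x < v]; at [x = u] the mass
    before [x] vanishes, which identifies the total mass. *)
Lemma mass_le_eq K L : measurable K -> measurable L -> K `<=` B -> L `<=` B ->
  (forall x y, u <= x <= v -> u <= y <= v ->
    \int[mu]_(q in K) `|y - g q| - \int[mu]_(q in K) `|x - g q| =
    \int[mu]_(q in L) `|y - g q| - \int[mu]_(q in L) `|x - g q|) ->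
  forall x, mu (mass_le K x) = mu (mass_le L x).
Proof.
move=> mK mL KB LB KL.
have fin D : measurable D -> D `<=` B -> mu D \is a fin_num.
  exact: fin_num_sub_box.
have m_le D x : measurable D -> measurable (mass_le D x).
  by move=> mD; apply: measurable_slab => //; exact: measurable_itv.
have sub_le D x : D `<=` B -> mass_le D x `<=` B by move=> DB q [/DB].
have step x : u <= x < v -> 2 * fine (mu (mass_le K x)) - fine (mu K) =
    2 * fine (mu (mass_le L x)) - fine (mu L).
  move=> /andP[ux xv]; apply/eqP; rewrite -subr_eq0 -normr_le0 leNgt; apply/negP.
  set D := _ - _ => D0.
  (* The slopes differ by at most [4 * W * h]; this [h] makes the bound half of
     the supposed difference. *)
  pose h := Num.min (v - x) (`|D| / (8 * W)).
  have h0 : 0 < h.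
    by rewrite lt_min subr_gt0 xv/= divr_gt0// mulr_gt0.
  have hx : h <= v - x by rewrite ge_min lexx.
  have hW : h * (8 * W) <= `|D|.
    by rewrite -ler_pdivlMr ?mulr_gt0// ge_min lexx orbT.
  have := abs_increment x mK KB h0; have := abs_increment x mL LB h0.
  rewrite KL; last 2 first.
  - by rewrite ux ltW.
  - by apply/andP; split; lra.
  move=> HL HK; have hD := close_slopes h0 HK HL.
  move: hD; rewrite -/D expr2; have hh : 0 < W * (h * h) by rewrite !mulr_gt0.
  have := ler_wpM2l (ltW h0) hW.
  lra.
have edge D : measurable D -> D `<=` B -> mu (mass_le D u) = 0%E.
  move=> mD DB; apply/eqP; rewrite -measure_le0 -g_edge.
  apply: le_measure; rewrite ?inE//; first exact: m_le.
    by apply: measurable_slab; [exact: measurable_box|exact: measurable_itv].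
  by move=> q [/DB].
have total : fine (mu K) = fine (mu L).
  have := step u; rewrite lexx uv => /(_ isT).
  by rewrite !edge//; lra.
have full D x : D `<=` B -> v <= x -> mass_le D x = D.
  move=> DB vx; apply/seteqP; split => q; first by case.
  by move=> Dq; split => //=; rewrite in_itv/=; have := gB (DB _ Dq); lra.
have none D x : D `<=` B -> x < u -> mass_le D x = set0.
  move=> DB xu; apply/seteqP; split => q // [/DB/gB + /=].
  by rewrite in_itv/=; lra.
move=> x; case: (ltP x u) => xu; first by rewrite !none.
case: (leP v x) => xv.
  by rewrite !full// -[LHS]fineK ?fin// -[RHS]fineK ?fin// total.
have := step x; rewrite xu xv => /(_ isT); rewrite total => /(addIr _) e.
rewrite -[LHS]fineK; last by apply: fin; [exact: m_le|exact: sub_le].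
rewrite -[RHS]fineK; last by apply: fin; [exact: m_le|exact: sub_le].
by congr EFin; lra.
Qed.

End coordinate_mass.

(** The distributions of [g] on [K] and [L] are finite measures on the line with
    the same distribution function. *)
Lemma slab_mass_eq (R : realType) (g : plane R -> R) (K L : set (plane R)) :
  measurable_fun setT g -> measurable K -> measurable L ->
  (lebesgue2 K < +oo)%E -> (lebesgue2 L < +oo)%E ->
  (forall x, lebesgue2 (mass_le g K x) = lebesgue2 (mass_le g L x)) ->
  forall P : set (measurableTypeR R), measurable P ->
    lebesgue2 (K `&` g @^-1` P) = lebesgue2 (L `&` g @^-1` P).
Proof.
move=> mg mK mL Kfin Lfin KL P mP.
have mpre D Q : measurable D -> measurable (Q : set (measurableTypeR R)) ->
    measurable (D `&` g @^-1` Q).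
  by move=> mD mQ; apply: measurable_slab.
(* The distribution of [g] on [D], as a measure on the line. *)
have [nu nuE] : exists nu : forall D (mD : measurable D),
      {measure set (measurableTypeR R) -> \bar R},
    forall D mD Q, nu D mD Q = lebesgue2 (D `&` g @^-1` Q).
  unshelve eexists.
    move=> D mD.
    exact: (pushforward (mrestr lebesgue2 mD) (g : plane R -> measurableTypeR R)).
  by move=> ? ? Q /=; rewrite [_ `&` (_ @^-1` _)]setIC.
rewrite -(nuE _ mK) -(nuE _ mL).
apply: (@measure_unique _ R (measurableTypeR R) (@ocitv R)
  (fun n => `](- n%:R)%R, n%:R]%classic) erefl (@ocitvI R)) => //.
- by move=> n; apply: is_ocitv.
- exact: bigcup_itvT.
- move=> _ [[x y] /= _ <-]; rewrite !nuE.
  have [yx|xy] := leP y x.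
    by rewrite set_itv_ge ?bnd_simp -?leNgt// preimage_set0 !setI0 !measure0.
  have slabE D : D `&` g @^-1` `]x, y] = mass_le g D y `\` mass_le g D x.
    apply/seteqP; split => q.
      by move=> [Dq /=]; rewrite in_itv/= => xyq; split;
        [split => //=|case=> _ /=]; rewrite in_itv/=; lra.
    move=> [[Dq /=]]; rewrite in_itv/= => qy nx; split => //=.
    rewrite in_itv/= qy andbT ltNge.
    by apply/negP => qx; apply: nx; split => //=; rewrite in_itv.
  have massD D : measurable D -> (lebesgue2 D < +oo)%E ->
      lebesgue2 (D `&` g @^-1` `]x, y]) =
      (lebesgue2 (mass_le g D y) - lebesgue2 (mass_le g D x))%E.
    move=> mD Dfin; rewrite slabE measureD//.
    - rewrite setIidr// => q [Dq /=]; rewrite in_itv/= => qx; split => //=.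
      by rewrite in_itv/=; lra.
    - by apply: mpre => //; exact: measurable_itv.
    - by apply: mpre => //; exact: measurable_itv.
    - apply: le_lt_trans Dfin; apply: le_measure; rewrite ?inE//.
        by apply: mpre => //; exact: measurable_itv.
      by move=> q [].
  rewrite !massD ?KL//.
- move=> n; rewrite nuE; apply: le_lt_trans Kfin; apply: le_measure; rewrite ?inE//.
  by apply: mpre => //; exact: measurable_itv.
Qed.

(** * Conic functions determine X-rays *)

Lemma lebesgue2_ysection (R : realType) (A : set (plane R)) : measurable A ->
  lebesgue2 A = (\int[lebesgue_measure]_y lebesgue_measure (ysection A y))%E.
Proof.
move=> mA; rewrite -[RHS]/((lebesgue_measure \x^ lebesgue_measure)%E A).
apply: product_measure_unique => // X Y mX mY.
exact: product_measure2E.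
Qed.

Lemma integral_Yray (R : realType) (K : set (plane R))
    (E : set (measurableTypeR R)) :
  measurable K -> measurable E ->
  (\int[lebesgue_measure]_(x in E) Yray K x)%E = lebesgue2 (K `&` fst @^-1` E).
Proof.
move=> mK mE; rewrite integral_mkcond; apply: eq_integral => x _.
rewrite patchE /Yray; case: ifPn => [xE|xE].
  congr lebesgue_measure; apply/seteqP; split => y /xsectionP; rewrite /xsection/=.
    by move=> Kxy; apply/mem_set; split => //; exact: set_mem.
  by case=> Kxy _; exact: mem_set.
rewrite /= (_ : xsection _ _ = set0) ?measure0//.
apply/seteqP; split => // y /xsectionP[_ /= Ex].
by move: xE; rewrite notin_setE.
Qed.

Lemma integral_Xray (R : realType) (K : set (plane R))
    (E : set (measurableTypeR R)) :
  measurable K -> measurable E ->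
  (\int[lebesgue_measure]_(y in E) Xray K y)%E = lebesgue2 (K `&` snd @^-1` E).
Proof.
move=> mK mE; rewrite lebesgue2_ysection; last first.
  exact: (measurable_slab (@measurable_snd _ _ _ _) mK mE).
rewrite integral_mkcond; apply: eq_integral => y _.
rewrite patchE /Xray; case: ifPn => [yE|yE].
  congr lebesgue_measure; apply/seteqP; split => x /ysectionP; rewrite /ysection/=.
    by move=> Kxy; apply/mem_set; split => //; exact: set_mem.
  by case=> Kxy _; exact: mem_set.
rewrite /= (_ : ysection _ _ = set0) ?measure0//.
apply/seteqP; split => // x /ysectionP[_ /= Ey].
by move: yE; rewrite notin_setE.
Qed.

Lemma ae_eq_of_integrals (R : realType) (f g : measurableTypeR R -> \bar R) :
  measurable_fun setT f -> measurable_fun setT g ->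
  (forall x, 0 <= f x)%E -> (\int[lebesgue_measure]_x f x < +oo)%E ->
  (forall E : set (measurableTypeR R), measurable E ->
    \int[lebesgue_measure]_(x in E) f x = \int[lebesgue_measure]_(x in E) g x)%E ->
  {ae @lebesgue_measure R, forall x, f x = g x}.
Proof.
move=> mf mg f0 fi fg.
have := @integral_ae_eq _ _ _ (@lebesgue_measure R) setT measurableT g f.
have if_ : lebesgue_measure.-integrable setT f.
  apply/integrableP; split => //.
  by under eq_integral do rewrite gee0_abs//.
move=> /(_ if_ mg (fun E _ mE => fg E mE)).
by apply: filterS => x /(_ Logic.I).
Qed.

Lemma conic_fun_determines_Xrays (R : realType) (a b c d : R)
    (K L : set (plane R)) :
  a < b -> c < d -> closed (K : set (R * R)) -> closed (L : set (R * R)) ->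
  K `<=` box a b c d -> L `<=` box a b c d ->
  (forall p, box a b c d p -> conic_fun K p = conic_fun L p) ->
  same_Xrays_ae K L.
Proof.
move=> ab cd cK cL KB LB KL.
have mK := closed_measurable_plane cK; have mL := closed_measurable_plane cL.
have leab := ltW ab; have lecd := ltW cd.
have Kfin := lebesgue2_sub_box leab lecd mK KB.
have Lfin := lebesgue2_sub_box leab lecd mL LB.
have sub_le (x y z t : R) (S : set (plane R)) : measurable S -> x <= y -> z <= t ->
    S `<=` box x y z t -> (lebesgue2 S <= ((y - x) * (t - z))%:E)%E.
  move=> mS xy zt SB; rewrite -lebesgue2_box//; apply: le_measure; rewrite ?inE//.
  exact: measurable_box.
have mB : measurable (box a b c d : set (plane R)) by exact: measurable_box.
have gfst : forall E : set (measurableTypeR R), measurable E ->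
    lebesgue2 (K `&` fst @^-1` E) = lebesgue2 (L `&` fst @^-1` E).
  apply: (slab_mass_eq (@measurable_fst _ _ _ _) mK mL Kfin Lfin).
  apply: (@mass_le_eq _ a b c d leab lecd fst
    (@measurable_fst _ _ _ _) a b (d - c)) => //.
  - by rewrite subr_gt0.
  - by move=> q [/=]; rewrite in_itv.
  - move=> x h h0; rewrite mulrC (_ : h = x + h - x); last by ring.
    apply: sub_le => //.
    + exact: (measurable_slab (@measurable_fst _ _ _ _) mB (measurable_itv _)).
    + lra.
    + move=> q [[_ q2] /=]; rewrite in_itv/= => q1; split => //=.
      by rewrite in_itv/=; lra.
  - apply/eqP; rewrite -measure_le0.
    apply: (le_trans (sub_le a a c d _ _ _ _ _)) => //; last by rewrite subrr mul0r.
    + exact: (measurable_slab (@measurable_fst _ _ _ _) mB (measurable_itv _)).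
    + move=> q [[/= q1 q2] /=]; move: q1; rewrite in_itv/= => q1 qa.
      by split => //=; rewrite in_itv/=; move: qa; rewrite in_itv/=; lra.
  - move=> x y xab yab.
    have Bx z : a <= z <= b -> box a b c d (z, c).
      by move=> zab; split => /=; rewrite in_itv/= ?lexx.
    have := KL _ (Bx _ xab); have := KL _ (Bx _ yab).
    by rewrite !(conic_funE leab lecd)//=; lra.
have gsnd : forall E : set (measurableTypeR R), measurable E ->
    lebesgue2 (K `&` snd @^-1` E) = lebesgue2 (L `&` snd @^-1` E).
  apply: (slab_mass_eq (@measurable_snd _ _ _ _) mK mL Kfin Lfin).
  apply: (@mass_le_eq _ a b c d leab lecd snd
    (@measurable_snd _ _ _ _) c d (b - a)) => //.
  - by rewrite subr_gt0.
  - by move=> q [_ /=]; rewrite in_itv.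
  - move=> x h h0; rewrite (_ : h = x + h - x); last by ring.
    apply: sub_le => //.
    + exact: (measurable_slab (@measurable_snd _ _ _ _) mB (measurable_itv _)).
    + lra.
    + move=> q [[q1 _] /=]; rewrite in_itv/= => q2; split => //=.
      by rewrite in_itv/=; lra.
  - apply/eqP; rewrite -measure_le0.
    apply: (le_trans (sub_le a b c c _ _ _ _ _)) => //; last by rewrite subrr mulr0.
    + exact: (measurable_slab (@measurable_snd _ _ _ _) mB (measurable_itv _)).
    + move=> q [[/= q1 q2] /=]; move: q2; rewrite in_itv/= => q2 qc.
      by split => //=; rewrite in_itv/=; move: qc; rewrite in_itv/=; lra.
  - move=> x y xcd ycd.
    have Bx z : c <= z <= d -> box a b c d (a, z).
      by move=> zcd; split => /=; rewrite in_itv/= ?lexx.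
    have := KL _ (Bx _ xcd); have := KL _ (Bx _ ycd).
    by rewrite !(conic_funE leab lecd)//=; lra.
split; apply: ae_eq_of_integrals.
- exact: measurable_fun_xsection.
- exact: measurable_fun_xsection.
- by move=> x; exact: measure_ge0.
- by rewrite integral_Yray// preimage_setT setIT.
- by move=> E mE; rewrite !integral_Yray// gfst.
- exact: measurable_fun_ysection.
- exact: measurable_fun_ysection.
- by move=> x; exact: measure_ge0.
- by rewrite integral_Xray// preimage_setT setIT.
- by move=> E mE; rewrite !integral_Xray// gsnd.
Qed.

(** * Stability *)

(** The balls are squares, whose points are at Euclidean distance at most
    [2 * r] from the centre. *)
Lemma hausdorff_dist_le (R : realType) (A B : set (R * R)) (r : R) : 0 < r ->
  (forall p, A p -> exists2 q, B q & ball p r q) ->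
  (forall q, B q -> exists2 p, A p & ball q r p) ->
  (hausdorff_dist A B <= (2 * r)%:E)%E.
Proof.
move=> r0 AB BA.
have dist_le (C : set (R * R)) (p q : R * R) :
    C q -> ball p r q -> (dist_to C p <= (2 * r)%:E)%E.
  move=> Cq [pq1 pq2]; apply: (@le_trans _ _ (euclidean_dist p q)%:E).
    by apply: ereal_inf_lbound; exists q.
  rewrite lee_fin /euclidean_dist -(@ger0_norm _ (2 * r)); last first.
    by rewrite mulr_ge0// ltW.
  rewrite -sqrtr_sqr ler_sqrt ?sqr_ge0//.
  move: pq1 pq2; rewrite /ball/= => pq1 pq2.
  rewrite -[_ ^+ 2 in X in X + _]real_normK ?num_real//.
  rewrite -[_ ^+ 2 in X in _ + X]real_normK ?num_real//.
  have := normr_ge0 (p.1 - q.1); have := normr_ge0 (p.2 - q.2).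
  by rewrite !expr2; nra.
rewrite /hausdorff_dist ge_max; apply/andP; split.
- apply: ge_ereal_sup => _ [p Ap <-].
  by have [q Bq pq] := AB p Ap; exact: dist_le pq.
- apply: ge_ereal_sup => _ [q Bq <-].
  by have [p Ap qp] := BA q Bq; exact: dist_le qp.
Qed.

Lemma lipschitz_measurable (R : realType) (F : plane R -> R) (M : R) : 0 < M ->
  (forall p q, `|F p - F q| <= M * (`|p.1 - q.1| + `|p.2 - q.2|)) ->
  measurable_fun setT F.
Proof.
move=> M0 FM; apply: (measurability _ (RGenOInfty.measurableE R)) => //.
move=> _ [_ [x ->] <-]; rewrite setTI; apply: open_measurable_plane.
rewrite openE => p /=; rewrite in_itv/= andbT => xFp.
have r0 : 0 < (F p - x) / (2 * M) by rewrite divr_gt0 ?subr_gt0 ?mulr_gt0.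
apply/nbhs_ballP; exists ((F p - x) / (2 * M)) => //= q [pq1 pq2].
rewrite /= in_itv/= andbT; have := FM p q; move: pq1 pq2; rewrite /ball/=.
rewrite !ltr_pdivlMr ?mulr_gt0// ler_norml; move: (`|_|) (`|_|) => s t.
lra.
Qed.

Section L1_sup.
Context {R : realType} {a b c d : R}.
Hypotheses (ab : a < b) (cd : c < d).
Local Notation B := (box a b c d).
Local Notation mu := (@lebesgue2 R).

Lemma hv_class_closed L : hv_class B L -> closed L.
Proof. by case=> _ Lco _ _ _; apply: compact_closed Lco; exact: norm_hausdorff. Qed.

Lemma hv_class_sub L : hv_class B L -> L `<=` B.
Proof. by case=> _ _ _ _ /(bounding_box_sub_box _ (ltW ab) (ltW cd)). Qed.

Lemma hv_class_measurable L : hv_class B L -> measurable (L : set (plane R)).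
Proof. by move=> /hv_class_closed; exact: closed_measurable_plane. Qed.

Lemma conic_fun_hv_lipschitz L p q : hv_class B L ->
  `|conic_fun L p - conic_fun L q| <=
    (b - a) * (d - c) * (`|p.1 - q.1| + `|p.2 - q.2|).
Proof.
move=> hL; have mL := hv_class_measurable hL; have LB := hv_class_sub hL.
rewrite mulrC.
apply: (le_trans (conic_fun_lipschitz (ltW ab) (ltW cd) p q mL LB)).
apply: ler_wpM2l; first by rewrite addr_ge0.
rewrite -lee_fin fineK; last exact: (fin_num_sub_box (ltW ab) (ltW cd)).
rewrite -(lebesgue2_box (ltW ab) (ltW cd)); apply: le_measure; rewrite ?inE//.
exact: measurable_box.
Qed.

(** If [|f_L - f_K|] is at least [eta / 2] at some point of the box, it is at
    least [eta / 4] on a square of side [s] in the box that contains this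
    point, where [s] depends only on [eta] and on the box. *)
Lemma L1_small_sup_small K eta : hv_class B K -> 0 < eta ->
  exists2 delta : R, 0 < delta & forall L, hv_class B L ->
    (L1_norm B (conic_fun L \- conic_fun K)%R < delta%:E)%E ->
    (sup_norm B (conic_fun L \- conic_fun K)%R < eta%:E)%E.
Proof.
move=> hK eta0.
set V := (b - a) * (d - c).
have V0 : 0 < V by rewrite mulr_gt0 ?subr_gt0.
(* [F] is Lipschitz with constant [2 * V] for the l1 distance, and two points
   of a square of side [s] are at l1 distance at most [2 * s]. *)
pose s := Num.min (Num.min (b - a) (d - c)) (eta / (16 * V)).
have s0 : 0 < s by rewrite !lt_min !subr_gt0 ab cd divr_gt0// mulr_gt0.
have sab : s <= b - a by rewrite !ge_min lexx.
have scd : s <= d - c by rewrite !ge_min lexx orbT.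
have sV : s * (16 * V) <= eta.
  rewrite -ler_pdivlMr; first by rewrite /s ge_min lexx orbT.
  by rewrite mulr_gt0.
exists (eta / 4 * s ^+ 2); first by rewrite !mulr_gt0// exprn_gt0.
move=> L hL; apply: contraTT; rewrite -!leNgt => sup_eta.
set F := (_ \- _)%R.
have FM p q : `|F p - F q| <= (2 * V) * (`|p.1 - q.1| + `|p.2 - q.2|).
  rewrite /F/= (_ : _ - _ = (conic_fun L p - conic_fun L q) -
    (conic_fun K p - conic_fun K q)); last by ring.
  rewrite (le_trans (ler_normB _ _))//.
  have := conic_fun_hv_lipschitz p q hL.
  by have := conic_fun_hv_lipschitz p q hK; rewrite -/V; lra.
have [p Bp Fp] : exists2 p, B p & eta / 2 <= `|F p|.
  apply: contrapT => nF.
  have : (sup_norm B F <= (eta / 2)%:E)%E.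
    apply: ge_ereal_sup => _ [p Bp <-]; rewrite lee_fin leNgt; apply/negP => Fp.
    by apply: nF; exists p => //; exact: ltW.
  by move=> /(le_trans sup_eta); rewrite lee_fin; lra.
(* The lower left corner of a square of side [s] in the box that contains
   [p]. *)
pose x := Num.min p.1 (b - s); pose y := Num.min p.2 (d - s).
have [px1 px2 ax xb] : [/\ x <= p.1, p.1 <= x + s, a <= x & x + s <= b].
  move: Bp => [/=]; rewrite in_itv/= => p1 _.
  by rewrite /x /Num.min; case: ltP => ?; split; lra.
have [py1 py2 cy yd] : [/\ y <= p.2, p.2 <= y + s, c <= y & y + s <= d].
  move: Bp => [/= _]; rewrite in_itv/= => p2.
  by rewrite /y /Num.min; case: ltP => ?; split; lra.
pose Q := box x (x + s) y (y + s).
have QB : Q `<=` B.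
  move=> q [/=]; rewrite !in_itv/= => q1 q2; split => /=; rewrite in_itv/=; lra.
have mQ : measurable (Q : set (plane R)) by exact: measurable_box.
have FQ q : Q q -> eta / 4 <= `|F q|.
  move=> [/=]; rewrite !in_itv/= => q1 q2.
  have pq1 : `|p.1 - q.1| <= s by rewrite ler_norml; lra.
  have pq2 : `|p.2 - q.2| <= s by rewrite ler_norml; lra.
  have := FM p q; have : 2 * V * (`|p.1 - q.1| + `|p.2 - q.2|) <= 2 * V * (s + s).
    by apply: ler_wpM2l; [rewrite mulr_ge0// ltW|exact: lerD].
  have := lerB_dist (F p) (F q); lra.
have mF : measurable_fun setT (fun q : plane R => (`|F q|)%:E).
  apply/measurable_EFinP; apply: measurableT_comp => //.
  by apply: lipschitz_measurable FM; rewrite mulr_gt0.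
have -> : ((eta / 4 * s ^+ 2)%:E = \int[mu]_(q in Q) (eta / 4)%:E)%E.
  rewrite integral_cst// lebesgue2_box ?lerDl ?(ltW s0)// -EFinM; congr EFin.
  by rewrite expr2; ring.
apply: (@le_trans _ _ (\int[mu]_(q in Q) (`|F q|)%:E)%E).
  apply: ge0_le_integral => //; first by move=> q _; rewrite lee_fin divr_ge0// ltW.
  exact: measurable_funS mF.
have mB : measurable (B : set (plane R)) by exact: measurable_box.
have mFB : measurable_fun (B : set (plane R)) (fun q : plane R => (`|F q|)%:E).
  exact: measurable_funS mF.
exact: ge0_subset_integral.
Qed.

End L1_sup.

Section stability.
Context {R : realType} {a b c d : R}.
Hypotheses (ab : a < b) (cd : c < d).
Local Notation B := (box a b c d).

(** Almost all [L], as well as the limit, lie between [core e] and [nbh e] of the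
    limit, for an [e] chosen by [nbh_core_small]. *)
Lemma conic_fun_ultra_limit (U : set_system (set (R * R))) {UU : UltraFilter U} :
  (\forall L \near U, hv_class B L) ->
  forall eta, 0 < eta -> \forall L \near U, forall p, B p ->
    `|conic_fun L p - conic_fun (ultra_limit U) p| < eta.
Proof.
move=> UB eta eta0; set L0 := ultra_limit U.
have hL0 : hv_class B L0 by exact: ultra_limit_hv_class.
have cL0 : closed L0 by exact: closed_ultra_limit.
have L0B := hv_class_sub ab cd hL0.
pose M := (b - a) + (d - c).
have M0 : 0 < M by rewrite addr_gt0 ?subr_gt0.
have [e e0 small] := nbh_core_small (ltW ab) (ltW cd) cL0 (divr_gt0 eta0 M0).
pose N : set (plane R) := B `&` nbh e L0.
pose C : set (plane R) := core e L0.
have mC : measurable C by apply: open_measurable_plane; exact: open_core.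
have mN : measurable N.
  apply: measurableI; first exact: measurable_box.
  by apply: open_measurable_plane; exact: open_nbh.
have NB : N `<=` B by move=> q [].
have mNC : measurable (N `\` C) by exact: measurableD.
have fNC : M * fine (lebesgue2 (N `\` C)) < eta.
  rewrite mulrC -ltr_pdivlMr// -lte_fin fineK//.
  by apply: (fin_num_sub_box (ltW ab) (ltW cd)) => // q [/NB].
have core_in L : hv_class B L ->
    (forall p, L0 p -> exists2 q, L q & ball p e q) -> C `<=` L.
  move=> [_ Lco Lcn Lhv _] L0L.
  exact: subset_trans (core_approx L0L) (core_sub Lco Lcn Lhv).
have L0N : L0 `<=` N.
  by move=> q L0q; split; [exact: L0B|exists q => //; exact: ballxx].
have CL0 : C `<=` L0.
  by apply: core_in => // q L0q; exists q => //; exact: ballxx.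
have L0nbh : L0 `<=` nbh e L0 by move=> q /L0N[].
have near1 := near_sub_open (@compact_box R a b c d) (@open_nbh R e L0 e0)
  (near_sub_box ab cd UB) L0nbh.
have cpt : compact L0 by case: hL0.
have near2 := near_covered cpt e0.
apply: (filterS (F := U) _ (filterI (F := U) UB
  (filterI (F := U) (near1 UU UU) (near2 UU)))) => L [hL [Lnbh L0L]] p Bp.
apply: le_lt_trans fNC; apply: (conic_fun_close (ltW ab) (ltW cd)) => //.
- exact: hv_class_measurable hL.
- exact: closed_measurable_plane.
- exact: core_in.
- by move=> q Lq; split; [exact: (hv_class_sub ab cd hL)|exact: Lnbh].
Qed.

Lemma hausdorff_near_ultra_limit (U : set_system (set (R * R)))
    {UU : UltraFilter U} :
  (\forall L \near U, hv_class B L) ->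
  forall eps, 0 < eps -> \forall L \near U,
    (hausdorff_dist L (ultra_limit U) < eps%:E)%E.
Proof.
move=> UB eps eps0.
have e0 : 0 < eps / 4 by rewrite divr_gt0.
have cpt : compact (ultra_limit U) by exact: ultra_limit_compact UB.
have sub : ultra_limit U `<=` nbh (eps / 4) (ultra_limit U).
  by move=> q qU; exists q => //; exact: ballxx.
have near1 := near_sub_open (@compact_box R a b c d)
  (@open_nbh R (eps / 4) (ultra_limit U) e0)
  (near_sub_box ab cd UB) sub.
have near2 := near_covered cpt e0.
apply: (filterS (F := U) _ (filterI (F := U) (near1 UU UU) (near2 UU))) => L [Lnbh UL].
apply: (@le_lt_trans _ _ (2 * (eps / 4))%:E); last by rewrite lte_fin; lra.
apply: hausdorff_dist_le => // p /Lnbh[q qU qp]; exists q => //.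
exact: ball_sym.
Qed.

(** The sets [bad delta] generate a proper filter; the limit of a finer ultrafilter
    can serve as [K'] for almost all of these sets, which were chosen to have
    no such [K']. *)
Lemma sup_stability K eps : hv_class B K -> 0 < eps ->
  exists2 delta : R, 0 < delta & forall L, hv_class B L ->
    (sup_norm B (conic_fun L \- conic_fun K)%R < delta%:E)%E ->
    exists K', [/\ hv_class B K', same_Xrays_ae K K'
      & (hausdorff_dist L K' < eps%:E)%E].
Proof.
move=> hK eps0; apply: contrapT => nstab.
pose bad (delta : R) : set (set (R * R)) := [set L | [/\ hv_class B L,
  (sup_norm B (conic_fun L \- conic_fun K)%R < delta%:E)%E &
  ~ exists K', [/\ hv_class B K', same_Xrays_ae K K'
      & (hausdorff_dist L K' < eps%:E)%E]]].
have FF : ProperFilter (filter_from [set delta : R | 0 < delta] bad).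
  apply: filter_from_proper; first apply: filter_from_filter.
  - by exists 1 => /=.
  - move=> i j /= i0 j0; exists (Num.min i j); first by rewrite /= lt_min i0.
    move=> L [hL Lij nL]; split; split => //; apply: lt_le_trans Lij _;
      by rewrite lee_fin ge_min lexx ?orbT.
  - move=> i /= i0; apply: contrapT => nbad; apply: nstab; exists i => // L hL Li.
    by apply: contrapT => nK'; apply: nbad; exists L.
have [U [UU FU]] := ultraFilterLemma FF.
have Ubad delta : 0 < delta -> U (bad delta) by move=> d0; apply: FU; exists delta.
have UB : \forall L \near U, hv_class B L.
  by apply: (filterS (F := U) _ (Ubad _ ltr01)) => L [].
have hL0 : hv_class B (ultra_limit U) by exact: ultra_limit_hv_class.
have same p : B p -> conic_fun K p = conic_fun (ultra_limit U) p.
  move=> Bp; apply/eqP; rewrite -subr_eq0 -normr_le0 leNgt; apply/negP => D0.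
  have D20 : 0 < `|conic_fun K p - conic_fun (ultra_limit U) p| / 2.
    by rewrite divr_gt0.
  have [L [/(_ p Bp) closeL [_ supL _]]] :=
    filter_ex (filterI (conic_fun_ultra_limit UB D20) (Ubad _ D20)).
  have : `|conic_fun L p - conic_fun K p| <
      `|conic_fun K p - conic_fun (ultra_limit U) p| / 2.
    rewrite -lte_fin; apply: le_lt_trans supL.
    by apply: ereal_sup_ubound; exists p.
  move: closeL; rewrite [`|conic_fun L p - conic_fun K p|]distrC => closeL KLp.
  have := ler_distD (conic_fun L p) (conic_fun K p) (conic_fun (ultra_limit U) p).
  lra.
have [L [[hL _ nL] near_L]] := filter_ex (filterI (Ubad _ ltr01)
  (hausdorff_near_ultra_limit UB eps0)).
apply: nL; exists (ultra_limit U); split => //.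
exact: (conic_fun_determines_Xrays ab cd (hv_class_closed hK)
  (@closed_ultra_limit _ U UU)
  (hv_class_sub ab cd hK) (hv_class_sub ab cd hL0) same).
Qed.

End stability.

Theorem theorem4 (R : realType) (a b c d : R) (hab : a < b) (hcd : c < d)
    (K : set (R * R)) (hK : hv_class (box a b c d) K)
    (eps : R) (heps : 0 < eps) :
  (exists2 delta : R, 0 < delta &
    forall L : set (R * R), hv_class (box a b c d) L ->
      (sup_norm (box a b c d) (conic_fun L \- conic_fun K)%R < delta%:E)%E ->
      exists K' : set (R * R),
        [/\ hv_class (box a b c d) K', same_Xrays_ae K K'
          & (hausdorff_dist L K' < eps%:E)%E]) /\
  (exists2 delta : R, 0 < delta &
    forall L : set (R * R), hv_class (box a b c d) L ->
      (L1_norm (box a b c d) (conic_fun L \- conic_fun K)%R < delta%:E)%E ->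
      exists K' : set (R * R),
        [/\ hv_class (box a b c d) K', same_Xrays_ae K K'
          & (hausdorff_dist L K' < eps%:E)%E]).
Proof.
have [eta eta0 sup_stab] := sup_stability hab hcd hK heps.
split; first by exists eta.
have [delta delta0 L1_sup] := L1_small_sup_small hab hcd hK eta0.
by exists delta => // L hL L1L; apply: sup_stab => //; exact: L1_sup.
Qed.
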